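(* Let $p\ge 1$ and let $E$ be a Banach lattice with a normalized basis $(e_i)$. If $E$ satisfies the lower $p$-estimate with constant $M$, then $\overline{E_{(p)}}$ is lattice isomorphic (lattice isometric if $M=1$) to $\ell_1$ via the map $(x_i)\in\ell_1\mapsto\sum_{i=1}^\infty x_i\odot e_i\in\overline{E_{(p)}}$, where the series is taken with respect to the operations of $\overline{E_{(p)}}$.
   Context: All Banach lattices are real. A Banach lattice with a basis $(e_i)$ is a Banach lattice $E$ with a Schauder basis $(e_i)$ that defines the order: $x=\sum_{i=1}^\infty x_ie_i$ satisfies $x\ge0$ if and only if $x_i\ge0$ for all $i$. (Such a basis is automatically $1$-unconditional.) Normalized means $\|e_i\|=1$ for all $i$. A Banach lattice $E$ satisfies the lower $p$-estimate with constant $M>0$ if $\bigl\|\sum_{k=1}^n x_k\bigr\|\ge\frac1M\bigl(\sum_{k=1}^n\|x_k\|^p\bigr)^{1/p}$ whenever $x_1,\dots,x_n\in E$ are (pairwise) disjoint. $\ell_1$ has its usual norm and coordinatewise order. $p$-concavification: for $t\in\mathbb R$ and $q>0$, $t^q$ means $|t|^q\operatorname{sign}t$. On $E$ define new operations $x\oplus y=(x^p+y^p)^{1/p}$ and $\alpha\odot x=\alpha^{1/p}x$ ($\alpha\in\mathbb R$), with the signed-power convention; the expression $(x^p+y^p)^{1/p}$ is computed coordinatewise with respect to $(e_i)$ (it agrees with the continuous homogeneous functional calculus of $E$). With these operations and the original order $E$ is a vector lattice, and $\|x\|_{(p)}=\inf\{\sum_{i=1}^n\|v_i\|^p : |x|\le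 v_1\oplus\dots\oplus v_n,\ v_i\ge 0\}$ is a lattice seminorm; the resulting space is $E_{(p)}$. For $E$ with a basis this seminorm is a norm, and $\overline{E_{(p)}}$ denotes the completion of $E_{(p)}$, a Banach lattice. *)

(* Defs.v *)
From HB Require Import structures.
From mathcomp Require Import all_boot all_order all_algebra.
From mathcomp Require Import all_classical all_reals all_analysis.
Import Order.TTheory GRing.Theory Num.Theory.
Import numFieldNormedType.Exports.

Set Implicit Arguments.
Unset Strict Implicit.
Unset Printing Implicit Defensive.

Local Open Scope classical_set_scope.
Local Open Scope ring_scope.

(* The order is carried by the mixin itself: Hierarchy-Builder refuses the
   join of [Order.Lattice] (or even [Order.Preorder]) with [NormedModule],
   because the structures of numeric fields already inherit from both. *)
HB.mixin Record isVectorLattice (R : realType) E of GRing.Lmodule R E := {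
  vle : E -> E -> Prop;
  vle_refl : forall x, vle x x;
  vle_anti : forall x y, vle x y -> vle y x -> x = y;
  vle_trans : forall y x z, vle x y -> vle y z -> vle x z;
  vle_addr : forall z x y, vle x y -> vle (x + z) (y + z);
  vscale_ge0 : forall (a : R) x, 0 <= a -> vle 0 x -> vle 0 (a *: x);
  vjoin : E -> E -> E;
  vmeet : E -> E -> E;
  vjoin_le : forall x y z, vle (vjoin x y) z <-> vle x z /\ vle y z;
  vle_meet : forall x y z, vle z (vmeet x y) <-> vle z x /\ vle z y }.

#[short(type="vectorLatticeType")]
HB.structure Definition VectorLattice (R : realType) :=
  { E of GRing.Lmodule R E & isVectorLattice R E }.

Arguments vle_anti {R s} [x y].
Arguments vle_trans {R s} [y x z].
Arguments vle_addr {R s} z [x y].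
Arguments vscale_ge0 {R s} [a x].

Definition vabs (R : realType) (E : vectorLatticeType R) (x : E) : E :=
  vjoin x (- x).

HB.mixin Record isNormedLattice (R : realType) E
    of VectorLattice R E & NormedModule R E := {
  vabs_le_norm : forall x y : E, vle (vabs x) (vabs y) -> `|x| <= `|y| }.

#[short(type="normedLatticeType")]
HB.structure Definition NormedLattice (R : realType) :=
  { E of VectorLattice R E & NormedModule R E & isNormedLattice R E }.

#[short(type="banachLatticeType")]
HB.structure Definition BanachLattice (R : realType) :=
  { E of NormedLattice R E & Complete E }.

Definition vdisjoint (R : realType) (E : vectorLatticeType R) (x y : E) : Prop :=
  vmeet (vabs x) (vabs y) = 0.

Definition lower_estimate (R : realType) (E : normedLatticeType R) (p M : R) :
    Prop :=
  forall (n : nat) (x : 'I_n -> E),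
    (forall k l, k != l -> vdisjoint (x k) (x l)) ->
    M^-1 * (\sum_(k < n) `|x k| `^ p) `^ p^-1 <= `|\sum_(k < n) x k|.

Definition lattice_homomorphism (R : realType) (G F : vectorLatticeType R)
    (T : G -> F) : Prop :=
  [/\ linear T,
      forall x y, T (vjoin x y) = vjoin (T x) (T y) &
      forall x y, T (vmeet x y) = vmeet (T x) (T y)].

Definition lattice_isomorphism (R : realType) (G F : normedLatticeType R)
    (T : G -> F) : Prop :=
  [/\ lattice_homomorphism T,
      bijective T &
      exists c C : R, [/\ 0 < c, 0 < C &
        forall x, c * `|x| <= `|T x| /\ `|T x| <= C * `|x|]].

Definition lattice_isometry (R : realType) (G F : normedLatticeType R)
    (T : G -> F) : Prop :=
  lattice_isomorphism T /\ forall x, `|T x| = `|x|.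

(* [j] exhibits the Banach lattice [F] as the norm completion of the vector
   lattice [G] equipped with the lattice norm [N]. *)
Definition is_completion (R : realType) (G : vectorLatticeType R) (N : G -> R)
    (F : banachLatticeType R) (j : G -> F) : Prop :=
  [/\ lattice_homomorphism j,
      forall x, `|j x| = N x &
      dense (range j)].

Record lattice_basis (R : realType) (E : banachLatticeType R) := LatticeBasis {
  basis_vec :> nat -> E;
  basis_schauder : forall x : E, exists! a : nat -> R,
    series (fun i => a i *: basis_vec i) @ \oo --> x;
  basis_order : forall (x : E) (a : nat -> R),
    series (fun i => a i *: basis_vec i) @ \oo --> x ->
    (vle 0 x <-> forall i, 0 <= a i) }.

Definition coord (R : realType) (E : banachLatticeType R)
    (e : lattice_basis E) (x : E) : nat -> R :=
  projT1 (cid (basis_schauder e x)).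

(* [spow q t] is the signed power t^q := |t|^q sign t. *)
Definition spow (R : realType) (q t : R) : R := Num.sg t * `|t| `^ q.

Section VectorLatticeTheory.
Context (R : realType) (E : vectorLatticeType R).
Implicit Types x y z : E.

Lemma vjoin_ub x y : vle x (vjoin x y) /\ vle y (vjoin x y).
Proof. by apply/vjoin_le; exact: vle_refl. Qed.

Lemma vabs_ge x : vle x (vabs x) /\ vle (- x) (vabs x).
Proof. exact: vjoin_ub. Qed.

Lemma vle_sub x y : vle x y <-> vle 0 (y - x).
Proof.
split=> [/(vle_addr (- x))|/(vle_addr x)]; first by rewrite subrr.
by rewrite add0r subrK.
Qed.

Lemma vle_add x y z t : vle x y -> vle z t -> vle (x + z) (y + t).
Proof.
move=> xy zt; apply: (vle_trans (vle_addr z xy)).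
by rewrite ![y + _]addrC; exact: vle_addr.
Qed.

Lemma vle_sum (I : Type) (r : seq I) (f g : I -> E) :
  (forall i, vle (f i) (g i)) -> vle (\sum_(i <- r) f i) (\sum_(i <- r) g i).
Proof.
move=> fg; elim: r => [|i r IH]; first by rewrite !big_nil; exact: vle_refl.
by rewrite !big_cons; exact: vle_add.
Qed.

End VectorLatticeTheory.

Section SignedPower.
Context (R : realType).
Implicit Types q s t : R.

Lemma spow0 q : spow q 0 = 0.
Proof. by rewrite /spow sgr0 mul0r. Qed.

Lemma spow1 q : spow q 1 = 1.
Proof. by rewrite /spow sgr1 mul1r normr1 powR1. Qed.

Lemma spowN q t : spow q (- t) = - spow q t.
Proof. by rewrite /spow sgrN normrN mulNr. Qed.

Lemma spowM q s t : spow q (s * t) = spow q s * spow q t.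
Proof. by rewrite /spow sgrM normrM powRM// mulrACA. Qed.

Lemma norm_spow q t : 0 < q -> `|spow q t| = `|t| `^ q.
Proof.
move=> q0; rewrite /spow normrM normr_sg (ger0_norm (powR_ge0 _ _)).
by have [->|] := eqVneq t 0; rewrite ?mul1r// normr0 powR0 ?gt_eqF// mulr0.
Qed.

Lemma sg_spow q t : Num.sg (spow q t) = Num.sg t.
Proof.
have [->|t0] := eqVneq t 0; first by rewrite spow0.
by rewrite /spow sgrM sgr_id (@gtr0_sg _ (_ `^ _)) ?mulr1// powR_gt0// normr_gt0.
Qed.

Lemma spowK q : 0 < q -> cancel (@spow R q) (spow q^-1).
Proof.
move=> q0 t; rewrite {1}/spow sg_spow norm_spow// -powRrM mulfV ?gt_eqF//.
by rewrite powRr1// -numEsg.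
Qed.

Lemma spowVK q : 0 < q -> cancel (@spow R q^-1) (spow q).
Proof. by move=> q0; rewrite -{2}(invrK q); apply: spowK; rewrite invr_gt0. Qed.

Lemma ler_spow q : 0 < q -> {homo (@spow R q) : s t / s <= t}.
Proof.
move=> q0 s t st.
have pos u : 0 <= u -> spow q u = u `^ q.
  rewrite le_eqVlt => /predU1P[<-|u0]; first by rewrite spow0 powR0// gt_eqF.
  by rewrite /spow gtr0_sg// mul1r gtr0_norm.
have mono u v : 0 <= u -> u <= v -> spow q u <= spow q v.
  move=> u0 uv; have v0 := le_trans u0 uv; rewrite !pos//.
  by apply: ge0_ler_powR; rewrite ?nnegrE// ltW.
have [s0|s0] := leP 0 s; first exact: mono.
have [t0|t0] := leP 0 t; last first.
  by rewrite -lerN2 -!spowN mono ?lerN2// oppr_ge0 ltW.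
apply: (@le_trans _ _ 0); last by rewrite pos// powR_ge0.
by rewrite -oppr_ge0 -spowN pos ?powR_ge0// oppr_ge0 ltW.
Qed.

Lemma ler_spowE q s t : 0 < q -> (spow q s <= spow q t) = (s <= t).
Proof.
move=> q0; apply/idP/idP => [st|]; last exact: ler_spow.
rewrite -(spowK q0 s) -(spowK q0 t); apply: ler_spow => //.
by rewrite invr_gt0.
Qed.

Lemma spow_add_bound q s t : 1 <= q ->
  `|spow q^-1 (spow q s + spow q t)| <= 2 * (`|s| + `|t|).
Proof.
move=> q1; have q0 : 0 < q := lt_le_trans ltr01 q1.
have key u v : spow q u + spow q v <= spow q (2 * (`|u| + `|v|)).
  have m0 : 0 <= spow q (`|u| + `|v|).
    by rewrite -(spow0 q); apply: ler_spow => //; rewrite addr_ge0.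
  have le2 : 2 <= spow q 2.
    by rewrite /spow gtr0_sg// mul1r gtr0_norm// le1r_powR// ler1n.
  rewrite spowM (le_trans _ (ler_wpM2r m0 le2))// mulr_natl mulr2n lerD//.
    by apply: ler_spow => //; rewrite (le_trans (ler_norm u))// lerDl.
  by apply: ler_spow => //; rewrite (le_trans (ler_norm v))// lerDr.
have q'0 : 0 < q^-1 by rewrite invr_gt0.
rewrite ler_norml -{1}(spowK q0 (2 * _)) -{2}(spowK q0 (2 * _)) -spowN.
apply/andP; split; apply: ler_spow => //.
by rewrite lerNl opprD -!spowN -(normrN s) -(normrN t).
Qed.

End SignedPower.

Section CoordinateTheory.
Context (R : realType) (E : banachLatticeType R) (e : lattice_basis E).
Implicit Types (x y : E) (a b : nat -> R).

Let S a := series (fun i => a i *: e i).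

Lemma coordP x : S (coord e x) @ \oo --> x.
Proof. by rewrite /coord; case: cid => a []. Qed.

Arguments coordP x : clear implicits.

Lemma coord_unique x a : S a @ \oo --> x -> coord e x = a.
Proof. by rewrite /coord; case: cid => b [] ? + h; apply. Qed.

Lemma coordD x y : coord e (x + y) = coord e x + coord e y.
Proof.
apply: coord_unique.
rewrite (_ : S _ = S (coord e x) + S (coord e y)); last first.
  by rewrite -seriesD; congr series; apply/funext => i; exact: scalerDl.
by apply: cvgD; exact: coordP.
Qed.

Lemma coordZ k x : coord e (k *: x) = k *: coord e x.
Proof.
apply: coord_unique; rewrite (_ : S _ = k *: S (coord e x)); last first.
  rewrite -seriesZ; congr series; apply/funext => i.
  by rewrite -[RHS]/(k *: (_ *: _)) scalerA.
by apply: cvgZl_tmp; exact: coordP.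
Qed.

Lemma coordN x : coord e (- x) = - coord e x.
Proof. by rewrite -scaleN1r coordZ scaleN1r. Qed.

Lemma coord0 : coord e 0 = 0.
Proof. by rewrite -(scale0r 0) coordZ scale0r. Qed.

Lemma coord_inj : injective (coord e).
Proof.
move=> x y xy; have hx := coordP x; rewrite xy in hx.
have yE := coordP y.
exact: (@norm_cvg_unique _ E _ _ x y hx yE).
Qed.

Lemma vle_coord x y : vle x y <-> forall i, coord e x i <= coord e y i.
Proof.
rewrite vle_sub (basis_order (coordP (y - x))) coordD coordN.
by split=> h i; have := h i; rewrite subr_ge0.
Qed.

Lemma basis_ge0 i : vle 0 (e i).
Proof.
have h : S (fun k => (k == i)%:R) @ \oo --> e i.
  apply: cvg_near_cst; exists i.+1 => // n /= ni.
  rewrite /S /series /= big_mkord (bigD1 (Ordinal ni))//= eqxx scale1r.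
  rewrite big1 ?addr0// => k /negP ki; case: eqP => [kI|]; last by rewrite scale0r.
  by exfalso; apply: ki; apply/eqP/val_inj.
by apply/(basis_order h) => k; rewrite ler0n.
Qed.

Lemma dominated_cvg y a : (forall i, `|a i| <= coord e y i) ->
  exists x, coord e x = a.
Proof.
move=> ay; suff /cvg_ex[x /coord_unique] : cvgn (S a) by exists x.
have le_basis u v i : u <= v -> vle (u *: e i) (v *: e i).
  move=> uv; apply/vle_sub; rewrite -scalerBl.
  by apply: vscale_ge0 (basis_ge0 i); rewrite subr_ge0.
apply: cauchy_cvg; apply/cauchy_seriesP => eps eps0.
have /cvg_cauchy/cauchy_seriesP/(_ _ eps0) : cvgn (S (coord e y)).
  by apply/cvg_ex; exists y; exact: coordP.
apply: filterS => -[m n] /=; apply: le_lt_trans.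
apply: vabs_le_norm; apply: vle_trans (proj1 (vabs_ge _)).
apply/vjoin_le; rewrite -sumrN; split; apply: vle_sum => i.
  by apply: le_basis; rewrite (le_trans (ler_norm _)).
by rewrite -scaleNr; apply: le_basis; rewrite (le_trans (ler_norm _))// normrN.
Qed.

Lemma coord_vabs x i : `|coord e x i| <= coord e (vabs x) i.
Proof.
have [/vle_coord/(_ i) h1 /vle_coord/(_ i)] := vabs_ge x.
by rewrite coordN ler_norml => h2; rewrite h1 lerNl h2.
Qed.

End CoordinateTheory.

Arguments coordP {R E} e x.

Section PCoordinates.
Context (R : realType) (p : R) (p_ge1 : 1 <= p).
Context (E : banachLatticeType R) (e : lattice_basis E).
Implicit Types x y z : E.

Definition pcoord x i := spow p (coord e x i).

Lemma oplus_subproof x y :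
  exists z : E, forall i, pcoord z i = pcoord x i + pcoord y i.
Proof.
have p_gt0 : 0 < p := lt_le_trans ltr01 p_ge1.
have [i|z zE] := @dominated_cvg _ _ e (2 *: (vabs x + vabs y))
  (fun i => spow p^-1 (pcoord x i + pcoord y i)).
  apply: le_trans (spow_add_bound _ _ p_ge1) _.
  rewrite coordZ coordD; apply: ler_wpM2l => //.
  by apply: lerD; exact: coord_vabs.
by exists z => i; rewrite {1}/pcoord zE spowVK.
Qed.

(* The element whose [i]-th coordinate is (x_i^p + y_i^p)^(1/p); it exists
   because these coordinates are dominated by those of 2 (|x| + |y|). *)
Definition oplus x y : E := projT1 (cid (oplus_subproof x y)).

Definition odot (a : R) x : E := spow p^-1 a *: x.

Lemma pcoord_inj x y : (forall i, pcoord x i = pcoord y i) -> x = y.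
Proof.
move=> xy; apply: (@coord_inj _ _ e); apply/funext => i.
by apply: (can_inj (spowK (lt_le_trans ltr01 p_ge1))); exact: xy.
Qed.

Lemma pcoord_oplus x y i : pcoord (oplus x y) i = pcoord x i + pcoord y i.
Proof. by rewrite /oplus; case: cid. Qed.

Lemma pcoord_odot a x i : pcoord (odot a x) i = a * pcoord x i.
Proof.
rewrite /pcoord coordZ -[_ i]/(_ * _) spowM spowVK//.
exact: lt_le_trans ltr01 p_ge1.
Qed.

Lemma pcoord0 i : pcoord 0 i = 0.
Proof. by rewrite /pcoord coord0 spow0. Qed.

Lemma pcoordN x i : pcoord (- x) i = - pcoord x i.
Proof. by rewrite /pcoord coordN spowN. Qed.

Lemma oplusA : associative oplus.
Proof.
by move=> x y z; apply: pcoord_inj => i; rewrite 4!pcoord_oplus addrA.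
Qed.

Lemma oplusC : commutative oplus.
Proof.
by move=> x y; apply: pcoord_inj => i; rewrite 2!pcoord_oplus addrC.
Qed.

Lemma oplus0 : left_id 0 oplus.
Proof.
by move=> x; apply: pcoord_inj => i; rewrite pcoord_oplus pcoord0 add0r.
Qed.

Lemma oplusN : left_inverse 0 -%R oplus.
Proof.
move=> x; apply: pcoord_inj => i.
by rewrite pcoord_oplus pcoordN pcoord0 addNr.
Qed.

Lemma odotA a b x : odot a (odot b x) = odot (a * b) x.
Proof. by rewrite /odot scalerA spowM. Qed.

Lemma odot1 : left_id 1 odot.
Proof. by move=> x; rewrite /odot spow1 scale1r. Qed.

Lemma odotDr : right_distributive odot oplus.
Proof.
move=> a x y; apply: pcoord_inj => i.
by rewrite pcoord_oplus 3!pcoord_odot pcoord_oplus mulrDr.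
Qed.

Lemma odotDl x : {morph (fun a => odot a x) : a b / a + b >-> oplus a b}.
Proof.
move=> a b; apply: pcoord_inj => i.
by rewrite pcoord_oplus 3!pcoord_odot mulrDl.
Qed.

Lemma oplus_le z x y : vle x y -> vle (oplus x z) (oplus y z).
Proof.
have p_gt0 : 0 < p := lt_le_trans ltr01 p_ge1.
move=> /(vle_coord e) xy; apply/(vle_coord e) => i.
rewrite -(ler_spowE _ _ p_gt0) -!/(pcoord _ _) 2!pcoord_oplus lerD2r.
exact: ler_spow.
Qed.

Lemma odot_ge0 a x : 0 <= a -> vle 0 x -> vle 0 (odot a x).
Proof.
move=> a0; apply: vscale_ge0; rewrite -(spow0 p^-1).
by apply: ler_spow => //; rewrite invr_gt0; exact: lt_le_trans ltr01 p_ge1.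
Qed.

End PCoordinates.

(* The space E_(p): the carrier, the order, the joins and the meets of [E], with
   addition [oplus] and scaling [odot]. *)
Definition concav (R : realType) (p : R) (p_ge1 : 1 <= p)
  (E : banachLatticeType R) (e : lattice_basis E) : Type := E.

Section Concavification.
Context (R : realType) (p : R) (p_ge1 : 1 <= p).
Context (E : banachLatticeType R) (e : lattice_basis E).

Local Notation Ep := (concav p_ge1 e).

HB.instance Definition _ := Choice.copy Ep E.

HB.instance Definition _ := GRing.isZmodule.Build Ep
  (oplusA p_ge1 e) (oplusC p_ge1 e) (oplus0 p_ge1 e) (oplusN p_ge1 e).

HB.instance Definition _ := GRing.Zmodule_isLmodule.Build R Ep
  (@odotA R p E) (@odot1 R p E) (odotDr p_ge1 e) (odotDl p_ge1 e).

HB.instance Definition _ := isVectorLattice.Build R Ep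
  (@vle_refl R E) (@vle_anti R E) (@vle_trans R E)
  (@oplus_le R p p_ge1 E e) (@odot_ge0 R p p_ge1 E)
  (@vjoin_le R E) (@vle_meet R E).

End Concavification.

(* [\sum_i v i] is the [oplus]-sum of E_(p), while the norm is that of [E]. *)
Definition concav_norm (R : realType) (p : R) (p_ge1 : 1 <= p)
    (E : banachLatticeType R) (e : lattice_basis E) (x : concav p_ge1 e) : R :=
  inf [set s | exists (n : nat) (v : 'I_n.+1 -> concav p_ge1 e),
    [/\ forall i, vle 0 (v i),
        vle (vabs x) (\sum_i v i) &
        s = \sum_i `|(v i : E)| `^ p]].

(* The vector lattice l_1 of absolutely summable real sequences. *)
Section EllOne.
Context (R : realType).

Definition summable_pred : {pred nat -> R} :=
  [pred a : nat -> R | `[< cvgn [normed series a] >]].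

Record ell1 := Ell1 { ell1_val :> nat -> R; _ : ell1_val \in summable_pred }.

HB.instance Definition _ := [isSub for ell1_val].
HB.instance Definition _ := [Choice of ell1 by <:].

Lemma summableP (a : nat -> R) :
  reflect (cvgn [normed series a]) (a \in summable_pred).
Proof. by rewrite inE; exact: asboolP. Qed.

Lemma dominated_summable (a b : nat -> R) :
  (forall i, `|a i| <= b i) -> cvgn (series b) -> a \in summable_pred.
Proof.
move=> ab cb; apply/summableP; apply: (series_le_cvg _ _ ab cb) => // i.
exact: le_trans (ab i).
Qed.

Lemma summableD (a b : nat -> R) : a \in summable_pred ->
  b \in summable_pred -> cvgn (series (fun i => `|a i| + `|b i|)).
Proof. by move=> /summableP ca /summableP cb; exact: is_cvg_seriesD. Qed.

Lemma summable_submod : submod_closed summable_pred.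
Proof.
split.
  apply: (@dominated_summable _ 0) => [i|]; first by rewrite normr0.
  rewrite (_ : series 0 = fun=> 0); first exact: is_cvg_cst.
  by apply/funext => n; rewrite /series /= big1.
move=> k a b ca cb; have ck : k *: a \in summable_pred.
  apply: (@dominated_summable _ (`|k| *: (fun i => `|a i|))) => [i|].
    by rewrite -[X in `|X|]/(k * _) normrM.
  by apply: is_cvg_seriesZ; exact/summableP.
apply: dominated_summable (summableD ck cb) => i; exact: ler_normD.
Qed.

HB.instance Definition _ :=
  GRing.isSubmodClosed.Build R (nat -> R) summable_pred summable_submod.
HB.instance Definition _ := [SubChoice_isSubLmodule of ell1 by <:].

Implicit Types x y z : ell1.

Definition ell1_norm x : R := limn [normed series x].

Lemma ell1_cvg x : cvgn [normed series x].
Proof. by apply/summableP; case: x. Qed.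

Lemma ell1_le_norm x y : (forall i, `|x i| <= `|y i|) ->
  ell1_norm x <= ell1_norm y.
Proof. by move=> xy; apply: lim_series_le xy; exact: ell1_cvg. Qed.

Lemma ell1_normD x y : ell1_norm (x + y) <= ell1_norm x + ell1_norm y.
Proof.
rewrite /ell1_norm -lim_seriesD; [|exact: ell1_cvg..].
apply: lim_series_le => [||i]; [exact: ell1_cvg| |exact: ler_normD].
by apply: is_cvg_seriesD; exact: ell1_cvg.
Qed.

Lemma ell1_normZ k x : ell1_norm (k *: x) = `|k| * ell1_norm x.
Proof.
rewrite /ell1_norm -[RHS]/(_ *: _) -lim_seriesZ; last exact: ell1_cvg.
by congr (limn (series _)); apply/funext => i; exact: normrM.
Qed.

Lemma ell1_norm0_eq0 x : ell1_norm x = 0 -> x = 0.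
Proof.
move=> x0; apply/val_inj/funext => i; apply/normr0_eq0/eqP.
rewrite eq_le normr_ge0 andbT -x0.
rewrite /ell1_norm (_ : [normed series x] = series (fun i => `|x i|))//.
have nd : nondecreasing_seq (series (fun i => `|x i|)).
  by apply/nondecreasing_seqP => n; rewrite seriesSr lerDl.
have c : cvgn (series (fun i => `|x i|)) by exact: ell1_cvg.
refine (le_trans _ (nondecreasing_cvgn_le nd c i.+1)).
by rewrite seriesSr lerDr sumr_ge0.
Qed.

HB.instance Definition _ := Lmodule_isNormed.Build R ell1
  ell1_normD ell1_normZ ell1_norm0_eq0.

Definition ell1_le x y : Prop := forall i, x i <= y i.

Lemma ell1_max_subproof x y :
  (fun i => Num.max (x i) (y i)) \in summable_pred.
Proof.
apply: dominated_summable (summableD (valP x) (valP y)) => i /=.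
by rewrite /Num.max; case: ifP => _; rewrite ?lerDl ?lerDr.
Qed.

Lemma ell1_min_subproof x y :
  (fun i => Num.min (x i) (y i)) \in summable_pred.
Proof.
apply: dominated_summable (summableD (valP x) (valP y)) => i /=.
by rewrite /Num.min; case: ifP => _; rewrite ?lerDl ?lerDr.
Qed.

Definition ell1_max x y : ell1 := Ell1 (ell1_max_subproof x y).
Definition ell1_min x y : ell1 := Ell1 (ell1_min_subproof x y).

Lemma ell1_le_anti x y : ell1_le x y -> ell1_le y x -> x = y.
Proof.
by move=> xy yx; apply/val_inj/funext => i; apply/le_anti; rewrite xy yx.
Qed.

Lemma ell1_le_trans y x z : ell1_le x y -> ell1_le y z -> ell1_le x z.
Proof. by move=> xy yz i; exact: le_trans (yz i). Qed.

Lemma ell1_le_add z x y : ell1_le x y -> ell1_le (x + z) (y + z).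
Proof. by move=> xy i; rewrite lerD2r; exact: xy. Qed.

Lemma ell1_scale_ge0 (a : R) x : 0 <= a -> ell1_le 0 x -> ell1_le 0 (a *: x).
Proof. by move=> a0 x0 i; exact: mulr_ge0 (x0 i). Qed.

Lemma ell1_max_le x y z :
  ell1_le (ell1_max x y) z <-> ell1_le x z /\ ell1_le y z.
Proof.
split=> [h|[xz yz] i]; last by rewrite /= ge_max xz yz.
by split=> i; have := h i; rewrite /= ge_max => /andP[].
Qed.

Lemma ell1_le_min x y z :
  ell1_le z (ell1_min x y) <-> ell1_le z x /\ ell1_le z y.
Proof.
split=> [h|[zx zy] i]; last by rewrite /= le_min zx zy.
by split=> i; have := h i; rewrite /= le_min => /andP[].
Qed.

HB.instance Definition _ := isVectorLattice.Build R ell1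
  (fun x i => lexx (x i)) ell1_le_anti ell1_le_trans ell1_le_add ell1_scale_ge0
  ell1_max_le ell1_le_min.

Lemma ell1_vabs_le_norm x y : vle (vabs x) (vabs y) -> `|x| <= `|y|.
Proof.
have absE z i : (vabs z : ell1) i = `|z i| by exact: maxrN.
by move=> xy; apply: ell1_le_norm => i; have := xy i; rewrite !absE.
Qed.

HB.instance Definition _ := isNormedLattice.Build R ell1 ell1_vabs_le_norm.

End EllOne.

(* Main.v *)
(* For [y] in [E], the lower p-estimate applied to the disjoint vectors y_i e_i
   gives sum_i |y_i|^p <= M^p ||y||^p, and summing this over any cover
   |x| <= v_1 (+) ... (+) v_n yields sum_i |x_i|^p <= M^p ||x||_(p). Conversely
   ||e_i||_(p) <= 1. Hence the map from l_1 is bounded above and below. Its range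
   contains E_(p), since the tails satisfy ||x - S_n x||_(p) <= ||x - S_n x||^p,
   and is closed since l_1 is complete; by density the map is onto. *)

Require Import Defs.
From mathcomp Require Import all_boot all_order all_algebra.
From mathcomp Require Import all_classical all_reals all_analysis.
Import Order.TTheory GRing.Theory Num.Theory.
Import numFieldNormedType.Exports.
Local Open Scope classical_set_scope.
Local Open Scope ring_scope.

Set Implicit Arguments.
Unset Strict Implicit.
Unset Printing Implicit Defensive.

(** * The modulus in vector lattices and normed lattices *)

Lemma vabs_id (R : realType) (E : vectorLatticeType R) (x : E) :
  vle 0 x -> vabs x = x.
Proof.
move=> x0; apply: vle_anti; last exact: (vabs_ge x).1.
apply/vjoin_le; split; first exact: vle_refl.
by apply: (vle_trans _ x0); apply: (vle_sub _ _).2; rewrite sub0r opprK.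
Qed.

(** Adding x <= |x| and -x <= |x| gives 0 <= 2|x|, which is then halved. *)
Lemma vabs_ge0 (R : realType) (E : vectorLatticeType R) (x : E) :
  vle 0 (vabs x).
Proof.
have [h1 h2] := vabs_ge x; have := vle_add h1 h2.
rewrite subrr -mulr2n -scaler_nat => /(@vscale_ge0 _ _ 2^-1).
by rewrite scalerA mulVf ?scale1r ?pnatr_eq0 //; apply; rewrite invr_ge0.
Qed.

Lemma norm_vabs (R : realType) (E : normedLatticeType R) (x : E) :
  `|vabs x| = `|x|.
Proof.
by apply/eqP; rewrite eq_le; apply/andP; split; apply: vabs_le_norm;
  rewrite (vabs_id (vabs_ge0 x)); exact: vle_refl.
Qed.

(** The reverse triangle inequality holds in the order, in both directions, and passes to norms by
    monotonicity. *)
Lemma vabs_dist (R : realType) (E : normedLatticeType R) (x y : E) :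
  `|vabs x - vabs y| <= `|x - y|.
Proof.
have half (u v : E) : vle (vabs u - vabs v) (vabs (u - v)).
  apply: (vle_sub _ _).2; rewrite opprB addrA; apply: (vle_sub _ _).1.
  apply/vjoin_le.
  have [h1 h2] := vabs_ge (u - v); have [k1 k2] := vabs_ge v; split.
    by have := vle_add h1 k1; rewrite subrK.
  by have := vle_add h2 k2; rewrite opprB addrAC subrr add0r.
apply: vabs_le_norm; apply/vjoin_le; split; first exact: half.
rewrite opprB; apply: vle_trans (half y x) _.
have [h1 h2] := vabs_ge (x - y); rewrite opprB in h2.
by apply/vjoin_le; rewrite opprB.
Qed.

Lemma cvg_vabs (R : realType) (E : normedLatticeType R) (u : nat -> E) (x : E) :
  u @ \oo --> x -> (fun n => vabs (u n)) @ \oo --> vabs x.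
Proof.
move=> /cvgrPdist_lt ux; apply/cvgrPdist_lt => eps eps0.
by apply: filterS (ux _ eps0) => n; apply: le_lt_trans; exact: vabs_dist.
Qed.

(* Joins and meets are determined by the order, so that only the modulus, a
   continuous operation, has to be followed through the completion. *)
Lemma lattice_homomorphism_bij (R : realType) (G F : vectorLatticeType R)
    (T : G -> F) :
  linear T -> bijective T -> (forall x, T (vabs x) = vabs (T x)) ->
  lattice_homomorphism T.
Proof.
move=> linT bijT absT.
have TB x y : T (x - y) = T x - T y.
  by rewrite addrC -scaleN1r linT scaleN1r addrC.
have T0 : T 0 = 0 by rewrite -(subrr 0) TB subrr.
(* The positive elements are those equal to their modulus, so an injective map commuting with the
   modulus preserves and reflects positivity. *)
have geT x : vle 0 x <-> vle 0 (T x).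
  split=> [/vabs_id <-|/vabs_id]; first by rewrite absT; exact: vabs_ge0.
  by rewrite -absT => /(bij_inj bijT) <-; exact: vabs_ge0.
have leT x y : vle x y <-> vle (T x) (T y).
  by rewrite vle_sub geT TB -vle_sub.
have [S TK SK] := bijT.
split=> [//|x y|x y]; apply: vle_anti.
- rewrite -[vjoin (T x) _]SK; apply/leT/vjoin_le; split; apply/leT;
  by rewrite SK; have [] := vjoin_ub (T x) (T y).
- by apply/vjoin_le; split; apply/leT; have [] := vjoin_ub x y.
- apply/vle_meet; split; apply/leT;
  by have [] := (vle_meet x y (vmeet x y)).1 (vle_refl _).
- rewrite -[X in vle X _]SK; apply/leT/vle_meet; split; apply/leT;
  by rewrite SK; have [] := (vle_meet (T x) (T y) _).1 (vle_refl _).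
Qed.

(** * Coordinates with respect to the basis *)

Section BasisCoordinates.
Context (R : realType) (E : banachLatticeType R) (e : lattice_basis E).

Lemma coord_basis i k : Defs.coord e (e i) k = (k == i)%:R.
Proof.
suff -> : Defs.coord e (e i) = fun k => (k == i)%:R by [].
apply: coord_unique; apply: cvg_near_cst; exists i.+1 => // n /= ni.
rewrite /series /= (bigD1_seq i) ?iota_uniq ?mem_index_iota //= eqxx scale1r.
by rewrite big1 ?addr0 // => l /negPf ->; rewrite scale0r.
Qed.

Lemma coord_series (a : nat -> R) n k :
  Defs.coord e (series (fun i => a i *: e i) n) k =
  if (k < n)%N then a k else 0.
Proof.
elim: n => [|n IH]; first by rewrite /series /= big_geq // Defs.coord0.
rewrite seriesSr coordD -[LHS]/(_ + _) coordZ -[X in _ + X]/(_ * _).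
rewrite IH coord_basis ltnS (leq_eqVlt k n).
by have [->|_] /= := eqVneq k n;
  rewrite ?ltnn ?mulr1 ?add0r ?mulr0 ?addr0.
Qed.

(** An element z with coordinates |x_i| exists by domination; it bounds x and -x from above, hence
    also their join [vabs x]. *)
Lemma coord_vabsE x i : Defs.coord e (vabs x) i = `|Defs.coord e x i|.
Proof.
apply/eqP; rewrite eq_le coord_vabs andbT.
have [z zE] := @Defs.dominated_cvg _ _ e (vabs x)
  (fun i => `|Defs.coord e x i|)
  (fun i => ltac:(by rewrite normr_id coord_vabs)).
rewrite -[X in _ <= X]/((fun i => `|Defs.coord e x i|) i) -zE.
apply: (vle_coord e _ _).1; apply/vjoin_le; split; apply/(vle_coord e) => k;
by rewrite zE ?coordN ?ler_norm // -normrN ler_norm.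
Qed.

(** This contains the 1-unconditionality of the basis; it is used to bound truncations. *)
Lemma le_norm_coord x y :
  (forall i, `|Defs.coord e x i| <= `|Defs.coord e y i|) -> `|x| <= `|y|.
Proof.
move=> xy; apply: vabs_le_norm; apply/(vle_coord e) => i.
by rewrite !coord_vabsE.
Qed.

(** The meet lies below both moduli, and at every index one of these has coordinate 0. *)
Lemma vdisjoint_basis a b k l : k != l -> vdisjoint (a *: e k) (b *: e l).
Proof.
move=> kl; have [h1 h2] :=
  (vle_meet (vabs (a *: e k)) (vabs (b *: e l)) _).1 (vle_refl _).
apply: vle_anti; last by apply/vle_meet; split; exact: vabs_ge0.
apply/(vle_coord e) => i; rewrite Defs.coord0.
have [il|il] := eqVneq i l.
  apply: le_trans ((vle_coord e _ _).1 h1 i) _.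
  by rewrite coord_vabsE coordZ -[_ i]/(_ * _) coord_basis il eq_sym (negPf kl)
    mulr0 normr0.
apply: le_trans ((vle_coord e _ _).1 h2 i) _.
by rewrite coord_vabsE coordZ -[_ i]/(_ * _) coord_basis (negPf il) mulr0
  normr0.
Qed.

End BasisCoordinates.

(** * Estimates for the concavified norm *)

Section Concavification.
Context (R : realType) (p : R) (p_ge1 : 1 <= p).
Context (E : banachLatticeType R) (e : lattice_basis E).
Local Notation Ep := (concav p_ge1 e).
Implicit Types x : Ep.

Let p_gt0 : 0 < p := lt_le_trans ltr01 p_ge1.

Lemma pcoord_sum (I : Type) (r : seq I) (v : I -> Ep) k :
  pcoord p e (\sum_(i <- r) v i) k = \sum_(i <- r) pcoord p e (v i) k.
Proof.
elim: r => [|i r IH]; first by rewrite !big_nil; exact: pcoord0.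
by rewrite !big_cons -IH; exact: pcoord_oplus.
Qed.

(** The coordinates of the basis vectors are 0 or 1, which signed powers fix, so the [oplus]-series
    has as p-coordinates the coordinates of the ordinary series. *)
Lemma pcoord_series (a : nat -> R) n k :
  pcoord p e (series (fun i => a i *: (e i : Ep)) n) k =
  if (k < n)%N then a k else 0.
Proof.
have <- : Defs.coord e (series (fun i => a i *: e i) n) k =
  if (k < n)%N then a k else 0 by exact: coord_series.
rewrite /series /= pcoord_sum.
have -> (s : seq nat) : Defs.coord e (\sum_(i <- s) a i *: e i) k =
    \sum_(i <- s) Defs.coord e (a i *: e i) k.
  elim: s => [|i s IH]; first by rewrite !big_nil Defs.coord0.
  by rewrite !big_cons coordD -IH.
apply: eq_bigr => i _; rewrite -[LHS]/(pcoord p e (odot p (a i) (e i)) k).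
rewrite pcoord_odot // coordZ -[RHS]/(_ * _) /pcoord coord_basis.
by case: (k == i); rewrite ?spow1 ?spow0.
Qed.

Lemma pcoord_vabs x k : pcoord p e (vabs x) k = `|pcoord p e x k|.
Proof.
rewrite norm_spow // -[LHS]/(spow p (Defs.coord e (vabs (x : E)) k)).
rewrite coord_vabsE /spow normr_id.
by have [->|x0] := eqVneq (Defs.coord e x k) 0;
  rewrite ?normr0 ?powR0 ?mulr0 ?gt_eqF // gtr0_sg ?normr_gt0 // mul1r.
Qed.

Lemma concav_norm_le x : concav_norm x <= `|(x : E)| `^ p.
Proof.
apply: ge_inf.
  by exists 0 => s [n [v [_ _ ->]]]; apply: sumr_ge0 => i _; exact: powR_ge0.
(* Covers are indexed by ['I_n.+1], so [n = 0] is the cover by the single vector |x|. *)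
exists 0%N, (fun=> vabs x); split=> [_||]; rewrite ?big_ord1.
- exact: (@vabs_ge0 R E).
- exact: vle_refl.
- by rewrite -[vabs x]/(vabs (x : E)) norm_vabs.
Qed.

(** The remainder formed with [oplus] and [odot] and the one formed in [E] have the same
    coordinates, hence are the same vector. *)
Lemma concav_norm_tail x n :
  concav_norm (x - series (fun i => pcoord p e x i *: (e i : Ep)) n) <=
  `|(x : E) - series (fun i => Defs.coord e x i *: e i) n| `^ p.
Proof.
apply: le_trans (concav_norm_le _) _; rewrite le_eqVlt; apply/orP; left.
apply/eqP; congr (`|_| `^ p); apply: (pcoord_inj p_ge1 (e := e)) => k.
rewrite [LHS](pcoord_oplus p_ge1) pcoordN pcoord_series.
rewrite [RHS]/pcoord coordD coordN -[X in _ = spow p X]/(_ k - _ k).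
rewrite coord_series.
by case: ifP => _; rewrite ?subrr ?subr0 ?spow0.
Qed.

Context (e_normalized : forall i : nat, `|e i| = 1).
Context (M : R) (M_gt0 : 0 < M) (E_lower : lower_estimate E p M).

Lemma sum_pcoord_le_norm (y : E) n :
  \sum_(k < n) `|pcoord p e y k| <= M `^ p * `|y| `^ p.
Proof.
set S := \sum_(k < n) _; have S0 : 0 <= S by exact: sumr_ge0.
have := @E_lower n (fun k => Defs.coord e y k *: e k)
  (fun k l => @vdisjoint_basis _ _ e _ _ k l).
have -> : \sum_(k < n) `|Defs.coord e y k *: e k| `^ p = S.
  by apply: eq_bigr => k _; rewrite normrZ e_normalized mulr1 norm_spow.
rewrite ler_pdivrMl // => h.
(* The disjoint vectors add up to a truncation of y, whose norm is at most that of y. *)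
have {}h : S `^ p^-1 <= M * `|y|.
  apply: le_trans h _; rewrite ler_pM2l //.
  apply: (le_norm_coord (e := e)) => i.
  rewrite -(big_mkord xpredT (fun k => Defs.coord e y k *: e k)).
  rewrite -[\sum_(_ <= _ < _) _]/(series (fun k => Defs.coord e y k *: e k) n).
  by rewrite coord_series; case: ifP; rewrite ?normr0.
rewrite -powRM ?(ltW M_gt0) // -[S]powRr1 // -(mulVf (lt0r_neq0 p_gt0)) powRrM.
by apply: ge0_ler_powR;
  rewrite ?nnegrE ?powR_ge0 ?mulr_ge0 ?(ltW p_gt0) ?(ltW M_gt0).
Qed.

Lemma sum_pcoord_le_concav_norm x n :
  \sum_(k < n) `|pcoord p e x k| <= M `^ p * concav_norm x.
Proof.
have Mp0 : 0 < M `^ p by exact: powR_gt0.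
rewrite -ler_pdivrMl //; apply: lb_le_inf.
  (* The infimum runs over a nonempty set: |x| covers itself. *)
  exists (\sum_(i < 1) `|(vabs x : E)| `^ p), 0%N, (fun=> vabs x).
  split=> //; first by move=> _; exact: (@vabs_ge0 R E).
  by rewrite big_ord1; exact: vle_refl.
move=> _ [m [v [v0 xv ->]]]; rewrite ler_pdivrMl // mulr_sumr.
(* Signed powers are monotone and turn the [oplus]-sum into a sum of reals, so the cover can be read
   off at each index. *)
have pv k : `|pcoord p e x k| <= \sum_i `|pcoord p e (v i) k|.
  have xvk : pcoord p e (vabs x) k <= pcoord p e (\sum_i v i) k.
    by apply: ler_spow => //; exact: (vle_coord e _ _).1.
  rewrite -pcoord_vabs (le_trans xvk) // pcoord_sum.
  by apply: ler_sum => i _; exact: ler_norm.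
apply: (@le_trans _ _ (\sum_(k < n) \sum_i `|pcoord p e (v i) k|)).
  by apply: ler_sum => k _; exact: pv.
rewrite exchange_big /=; apply: ler_sum => i _; exact: sum_pcoord_le_norm.
Qed.

End Concavification.

(** * Completeness of l_1 *)

Section EllOneComplete.
Context (R : realType).
Implicit Types x y : ell1 R.

Lemma sum_le_ell1_norm x n : \sum_(i < n) `|x i| <= `|x|.
Proof.
have nd : nondecreasing_seq (series (fun i => `|x i|)).
  by apply/nondecreasing_seqP => m; rewrite seriesSr lerDl.
have := nondecreasing_cvgn_le nd (@ell1_cvg R x) n.
by rewrite [X in X <= _]/series /= big_mkord.
Qed.

Lemma coord_le_ell1_norm x i : `|x i| <= `|x|.
Proof.
apply: le_trans (sum_le_ell1_norm x i.+1).
by rewrite big_ord_recr /= lerDr sumr_ge0.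
Qed.

Lemma ell1_norm_le x c : (forall n, \sum_(i < n) `|x i| <= c) -> `|x| <= c.
Proof.
move=> xc; apply: limr_le; first exact: ell1_cvg.
apply: nearW => n; have := xc n.
by rewrite -(big_mkord xpredT (fun i => `|x i|)).
Qed.

Lemma bounded_summable (a : nat -> R) c :
  (forall n, \sum_(i < n) `|a i| <= c) -> a \in @summable_pred R.
Proof.
move=> ac; apply/summableP.
suff: cvgn (series (fun i => `|a i|)) by [].
apply: nondecreasing_is_cvgn.
  by apply/nondecreasing_seqP => n; rewrite seriesSr lerDl.
by exists c => _ [n _ <-]; rewrite /series /= big_mkord.
Qed.

(** The limit is built coordinatewise; bounds on finite partial sums survive the limit and give norm
    convergence. *)
Lemma ell1_complete (x : nat -> ell1 R) : cauchy (x @ \oo) -> cvgn x.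
Proof.
move=> /cauchyP cx.
(* The centre c need not be a term of the sequence. *)
have cauchyx eps : 0 < eps -> exists c, \forall n \near \oo, `|c - x n| < eps.
  move=> eps0; have [c hc] := cx _ eps0; exists c.
  by move: hc; rewrite /nbhs /= -ball_normE.
have cvgi i : cvgn (fun n => x n i).
  apply: cauchy_cvg; apply/cauchyP => eps eps0.
  have [c hc] := cauchyx _ eps0; exists (c i).
  apply: filterS hc => n /=; rewrite -ball_normE /=.
  by apply: le_lt_trans; exact: (coord_le_ell1_norm (c - x n)).
pose a i := limn (fun n => x n i).
have near_sum eps c : (\forall n \near \oo, `|c - x n| < eps) ->
    forall k, \sum_(i < k) `|c i - a i| <= eps.
  (* With k fixed the sum is finite, so the limit in n can be taken term by term. *)
  move=> hc k; apply: (@ler_cvg_to _ \oo _ _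
      (fun n => \sum_(i < k) `|c i - x n i|) (fun=> eps)); last first.
  - apply: filterS hc => n /ltW; apply: le_trans.
    exact: (sum_le_ell1_norm (c - x n)).
  - exact: cvg_cst.
  apply: (cvg_big add_continuous) => i _; apply: cvg_norm.
  apply: cvgB; first exact: cvg_cst.
  exact: cvgi.
(* Summability of a is obtained through c1 - a, whose partial sums of moduli are at most 1; the
   limit is then c1 - (c1 - a). *)
have [c1 /near_sum hc1] := cauchyx _ ltr01.
have c1a : (fun i => c1 i - a i) \in @summable_pred R.
  exact: bounded_summable hc1.
have near_norm eps c y : (forall i, y i = a i) ->
    (\forall n \near \oo, `|c - x n| < eps) -> `|c - y| <= eps.
  move=> ya /near_sum hc; apply: ell1_norm_le => k.
  apply: le_trans (hc k); apply: ler_sum => i _.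
  by rewrite -ya lexx.
apply/cvg_ex; exists (c1 - Ell1 c1a); apply/cvgrPdist_lt => eps eps0.
(* Both x n and the limit lie within eps/2 of c. *)
have [c hc] := cauchyx _ (divr_gt0 eps0 (ltr0n R 2)).
have {}near_norm := near_norm _ c (c1 - Ell1 c1a) _ hc.
apply: filterS hc => n hn; rewrite (splitr eps).
apply: le_lt_trans (ler_distD c _ _) _; rewrite ler_ltD //.
rewrite distrC; apply: near_norm => i.
by rewrite -[LHS]/(c1 i - (c1 i - a i)) subKr.
Qed.

End EllOneComplete.

(** * The map from l_1 into the completion *)

Section Completion.
Context (R : realType) (p : R) (p_ge1 : 1 <= p).
Context (E : banachLatticeType R) (e : lattice_basis E).
Context (e_normalized : forall i : nat, `|e i| = 1).
Context (M : R) (M_gt0 : 0 < M) (E_lower : lower_estimate E p M).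
Context (F : banachLatticeType R) (j : concav p_ge1 e -> F).
Context (F_completion : is_completion (@concav_norm R p p_ge1 E e) j).

Local Notation Ep := (concav p_ge1 e).
Implicit Types (x y : ell1 R) (g : Ep).

(** The scaling under [j] is [odot], since [e i] is read in [Ep]; the series itself is formed in
    [F]. *)
Definition ell1_terms (x : ell1 R) (i : nat) : F := j (x i *: (e i : Ep)).
Definition ell1_map (x : ell1 R) : F := limn (series (ell1_terms x)).

Let linear_j : linear j. Proof. by case: F_completion => -[]. Qed.

Let norm_j g : `|j g| = concav_norm g.
Proof. by case: F_completion. Qed.

Let j0 : j 0 = 0.
Proof. by have := linear_j (-1) 0 0; rewrite scaler0 addr0 scaleN1r addNr. Qed.

Let jD g h : j (g + h) = j g + j h.
Proof. by have := linear_j 1 g h; rewrite !scale1r. Qed.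

Let jZ a g : j (a *: g) = a *: j g.
Proof. by have := linear_j a g 0; rewrite j0 !addr0. Qed.

Let jN g : j (- g) = - j g.
Proof. by rewrite -scaleN1r jZ scaleN1r. Qed.

Let jB g h : j (g - h) = j g - j h.
Proof. by rewrite jD jN. Qed.

Let vabs_j g : j (vabs g) = vabs (j g).
Proof. by case: F_completion => -[_ joinj _] _ _; rewrite /vabs joinj jN. Qed.

Let series_terms x n :
  series (ell1_terms x) n = j (series (fun i => x i *: (e i : Ep)) n).
Proof.
by elim: n => [|n IH]; rewrite ?seriesSr ?IH ?jD // /series /= !big_geq.
Qed.

Let norm_terms_le x i : `|ell1_terms x i| <= `|x i|.
Proof.
rewrite /ell1_terms jZ normrZ ler_piMr // norm_j.
by rewrite (le_trans (concav_norm_le _)) // e_normalized powR1.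
Qed.

Let normed_terms_cvg x : cvgn [normed series (ell1_terms x)].
Proof.
apply: (series_le_cvg _ _ (norm_terms_le x)) (@ell1_cvg R x) => i;
by rewrite normr_ge0.
Qed.

Lemma ell1_terms_cvg x : cvgn (series (ell1_terms x)).
Proof. by apply: normed_cvg; exact: normed_terms_cvg. Qed.

Let ell1_map_unique x l : series (ell1_terms x) @ \oo --> l -> ell1_map x = l.
Proof. exact: (@cvg_lim _ (@norm_hausdorff _ F)). Qed.

Lemma ell1_map_norm_le x : `|ell1_map x| <= `|x|.
Proof.
apply: (@le_trans _ _ (limn [normed series (ell1_terms x)])).
  by apply: lim_series_norm; exact: normed_terms_cvg.
apply: lim_series_le (norm_terms_le x); first exact: normed_terms_cvg.
exact: ell1_cvg.
Qed.

(** For fixed n, the bound on the first n p-coordinates applies to every partial sum of length m >=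
    n; m then tends to infinity. *)
Lemma ell1_map_norm_ge x : `|x| <= M `^ p * `|ell1_map x|.
Proof.
apply: ell1_norm_le => n.
apply: (@ler_cvg_to _ \oo _ _ (fun=> \sum_(i < n) `|x i|)
  (fun m => M `^ p * `|series (ell1_terms x) m|)).
- exact: cvg_cst.
- by apply: cvgMr; apply: cvg_norm; exact: ell1_terms_cvg.
exists n => // m /= nm; rewrite series_terms norm_j.
apply: le_trans (sum_pcoord_le_concav_norm e_normalized M_gt0 E_lower _ n).
apply: ler_sum => i _.
by rewrite pcoord_series (leq_trans (ltn_ord i)) // lexx.
Qed.

Lemma ell1_map_linear : linear ell1_map.
Proof.
move=> a x y; apply: ell1_map_unique.
have -> : series (ell1_terms (a *: x + y)) =
    a *: series (ell1_terms x) + series (ell1_terms y).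
  rewrite -seriesZ -seriesD; congr series; apply/funext => i.
  by rewrite /ell1_terms -[RHS]/(a *: j _ + j _) -jZ -jD scalerA -scalerDl.
by apply: cvgD; [apply: cvgZl_tmp|]; exact: ell1_terms_cvg.
Qed.

Let ell1_mapB x y : ell1_map (x - y) = ell1_map x - ell1_map y.
Proof. by rewrite addrC -scaleN1r ell1_map_linear scaleN1r addrC. Qed.

(** The identity holds for partial sums, coordinate by coordinate, and passes to the limit because
    the modulus is continuous. *)
Lemma ell1_map_vabs x : ell1_map (vabs x) = vabs (ell1_map x).
Proof.
apply: ell1_map_unique.
have -> : series (ell1_terms (vabs x)) =
    fun n => vabs (series (ell1_terms x) n).
  apply/funext => n; rewrite !series_terms -vabs_j; congr j.
  apply: (pcoord_inj p_ge1 (e := e)) => k.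
  rewrite pcoord_vabs !pcoord_series.
  by case: ifP; rewrite ?normr0 // => _; exact: maxrN.
by apply: cvg_vabs; exact: ell1_terms_cvg.
Qed.

(** The preimage is the sequence of p-coordinates of g, summable by the lower estimate. *)
Lemma ell1_map_pcoord g : exists x, ell1_map x = j g.
Proof.
have sg : pcoord p e g \in @summable_pred R.
  apply: bounded_summable => n.
  exact: (sum_pcoord_le_concav_norm e_normalized M_gt0 E_lower g n).
exists (Ell1 sg); apply: ell1_map_unique; apply/cvgrPdist_le => eps eps0.
(* The cap at 1 ensures d^p <= d <= eps, as p >= 1. *)
pose d := Num.min eps 1; have d0 : 0 < d by rewrite lt_min eps0 ltr01.
have /cvgrPdist_le/(_ d d0) := coordP e (g : E); apply: filterS => n gn.
rewrite series_terms -jB norm_j; apply: le_trans (concav_norm_tail g n) _.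
apply: (@le_trans _ _ (d `^ p)).
  by apply: ge0_ler_powR; rewrite ?nnegrE ?(ltW d0) // (le_trans ler01).
apply: (@le_trans _ _ d); last by rewrite ge_min lexx.
by apply: ge1r_powR; rewrite ?d0 // ge_min lexx orbT.
Qed.

Lemma ell1_map_surjective z : exists x, ell1_map x = z.
Proof.
have [_ _ dense_j] := F_completion.
(* The range contains that of [j], so it is dense. *)
have approx (n : nat) : exists x, `|z - ell1_map x| < n.+1%:R^-1.
  have n0 : 0 < n.+1%:R^-1 :> R by rewrite invr_gt0 ltr0n.
  have [w [zw [g _ gw]]] :=
    dense_j (ball z n.+1%:R^-1) (ex_intro _ z (ballxx z n0)) (ball_open z _).
  have [x xg] := ell1_map_pcoord g.
  by exists x; rewrite xg gw; rewrite -ball_normE in zw.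
have [x hx] := choice approx.
have cvgTx : ell1_map \o x @ \oo --> z.
  apply/cvgrPdist_lt => eps eps0.
  apply: filterS (near_infty_natSinv_lt (PosNum eps0)) => n.
  exact: lt_trans (hx n).
have Mp0 : 0 < M `^ p by exact: powR_gt0.
have [y xy] : exists y, x @ \oo --> y.
  apply/cvg_ex/ell1_complete/cauchyP => eps eps0.
  (* Two images within this distance of z differ by less than eps / M^p, so the lower bound puts
     their preimages within eps. *)
  have d0 : 0 < eps / M `^ p / 2 by rewrite !divr_gt0.
  have /cvgrPdist_lt/(_ _ d0)[N _ hN] := cvgTx; exists (x N), N => // n Nn /=.
  rewrite -ball_normE /=; apply: le_lt_trans (ell1_map_norm_ge _) _.
  rewrite -ltr_pdivlMl // [_ * eps]mulrC ell1_mapB (splitr (eps / _)).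
  apply: le_lt_trans (ler_distD z _ _) _; rewrite ltrD //.
    by rewrite distrC; apply: hN => /=.
  exact: hN.
(* The map is a contraction, so the images converge to the image of y as well as to z. *)
exists y; apply: (@norm_cvg_unique _ F _ _ _ _ _ cvgTx).
apply/cvgrPdist_lt => eps eps0.
have /cvgrPdist_lt/(_ _ eps0) := xy; apply: filterS => n.
by rewrite /= -ell1_mapB; apply: le_lt_trans; exact: ell1_map_norm_le.
Qed.

End Completion.

(** The completion enters as an arbitrary pair [F], [j], so every model of it is covered. *)
Theorem proposition21 (R : realType) (p : R) (p_ge1 : 1 <= p)
    (E : banachLatticeType R) (e : lattice_basis E)
    (e_normalized : forall i : nat, `|e i| = 1)
    (M : R) (M_gt0 : 0 < M) (E_lower : lower_estimate E p M)
    (F : banachLatticeType R) (j : concav p_ge1 e -> F)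
    (F_completion : is_completion (@concav_norm R p p_ge1 E e) j) :
  let terms (x : ell1 R) (i : nat) : F :=
    j (x i *: (e i : concav p_ge1 e)) in
  let T (x : ell1 R) : F := limn (series (terms x)) in
  [/\ forall x : ell1 R, cvgn (series (terms x)),
      lattice_isomorphism T &
      M = 1 -> lattice_isometry T].
Proof.
have Mp0 : 0 < M `^ p by exact: powR_gt0.
have norm_ge := ell1_map_norm_ge e_normalized M_gt0 E_lower F_completion.
have norm_le := ell1_map_norm_le e_normalized F_completion.
have linT := ell1_map_linear e_normalized F_completion.
have bijT : bijective (ell1_map j).
  (* The lower norm bound makes the kernel trivial. *)
  have injT : injective (ell1_map j).
    move=> x y xy; apply/eqP; rewrite -subr_eq0 -normr_le0.
    apply: le_trans (norm_ge _) _.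
    by rewrite addrC -scaleN1r linT xy scaleN1r addNr normr0 mulr0.
  have [S SK] := choice
    (ell1_map_surjective e_normalized M_gt0 E_lower F_completion).
  by exists S => // x; apply: injT; rewrite SK.
have isoT : lattice_isomorphism (ell1_map j).
  split=> //.
    apply: lattice_homomorphism_bij => // x.
    exact: (ell1_map_vabs e_normalized F_completion).
  exists (M `^ p)^-1, 1; split=> [||x]; rewrite ?invr_gt0 //.
  by rewrite mul1r ler_pdivrMl.
split=> //; first exact: (ell1_terms_cvg e_normalized F_completion).
(* For M = 1 the constant M^p is 1 and the two norm bounds meet. *)
move=> M1; split=> // x; apply/eqP; rewrite eq_le [_ <= `|x|]norm_le /=.
by apply: le_trans (norm_ge x) _; rewrite M1 powR1 mul1r.
Qed.
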